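(* Let $\tau>0$, $\varphi>0$, $d_i\ge0$ and $\tilde\psi_i>0$ for $i=1,\dots,N$ with $\sum_i d_i>0$, and let $\pi_A>0$ be the equilibrium premium, i.e. the unique positive solution of $\pi_A=\varphi D_A(\pi_A)$. Set $$W_i=W\!\left(\frac{d_i\pi_A\tau^2}{\tilde\psi_i}\right),\qquad s_i=\frac{d_ie^{-W_i}}{\sum_j d_je^{-W_j}},\qquad \omega=\sum_i s_i\,\frac{W_i}{1+W_i}.$$ Then $$\frac{d\log\pi_A}{d\log\varphi}=\frac{1}{1+\omega}.$$ Moreover $\frac{W_i}{1+W_i}\in(0,1)$ for every $i$ with $d_i>0$, so that $\omega\in(0,1)$ and $$\frac{d\log\pi_A}{d\log\varphi}\in\left(\tfrac12,1\right).$$ With $\tau,\varphi,(d_i)$ fixed, the elasticity $\frac{d\log\pi_A}{d\log\varphi}$ converges to $\frac12$ in the limit $\tilde\psi_i\to0$ for all $i$ (i.e. $\max_i\tilde\psi_i\to0$).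
   Context: There are finitely many operators $i=1,\dots,N$ with expected compliance shortfalls $d_i\ge0$ and normalized access-cost parameters $\tilde\psi_i>0$; $\tau>0$ is the cycle length. $W$ is the Lambert $W$ function on $[0,\infty)$, the inverse of $y\mapsto ye^y$ on $[0,\infty)$. For $\pi\ge0$ define $$\lambda_i^*(\pi)=\frac1\tau W\!\left(\frac{d_i\pi\tau^2}{\tilde\psi_i}\right),\qquad D_A(\pi)=\sum_i d_i e^{-\lambda_i^*(\pi)\tau}.$$ When $\sum_i d_i>0$, for each $\varphi>0$ the equation $\pi=\varphi D_A(\pi)$ has a unique positive solution, the equilibrium surrender-month return premium $\pi_A$, which depends on $\varphi$ and on the $\tilde\psi_i$. The elasticity is $\frac{d\log\pi_A}{d\log\varphi}=\frac{\varphi}{\pi_A}\frac{\partial\pi_A}{\partial\varphi}$ with $d_i,\tilde\psi_i,\tau$ held fixed. *)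

(* Defs.v *)
From HB Require Import structures.
From mathcomp Require Import all_boot all_order all_algebra.
From mathcomp Require Import all_classical all_reals all_analysis.

Set Implicit Arguments.
Unset Strict Implicit.
Unset Printing Implicit Defensive.

Import Order.TTheory GRing.Theory Num.Theory.
Import numFieldNormedType.Exports.

Local Open Scope classical_set_scope.
Local Open Scope ring_scope.

(* [pinv A f] inverts f restricted to A.  Since y |-> y e^y is an increasing
   bijection of [0, +oo[ onto itself, this is the principal branch of the
   Lambert function on [0, +oo[; values at negative arguments are irrelevant. *)
Definition lambertW (R : realType) : R -> R :=
  pinv (`[0, +oo[%classic : set R) (fun y : R => y * expR y).

Section model.
Context (R : realType) (N : nat).
(* Row vectors, so that the topology on psi is that of the max norm. *)
Implicit Types (tau phi p : R) (d psi : 'rV[R]_N) (i : 'I_N).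

Definition opt_rate tau d psi p i : R :=
  tau^-1 * lambertW (d 0 i * p * tau ^+ 2 / psi 0 i).

Definition agg_shortfall tau d psi p : R :=
  \sum_(i < N) d 0 i * expR (- (opt_rate tau d psi p i * tau)).

Definition is_equilibrium tau d psi phi p : Prop :=
  0 < p /\ p = phi * agg_shortfall tau d psi p.

(* The equilibrium premium pi_A, as a function of phi; the default value 0 is
   only taken when there is no equilibrium. *)
Definition premium tau d psi phi : R :=
  xget 0 [set p | is_equilibrium tau d psi phi p].

Definition elasticity tau d psi phi : R :=
  phi / premium tau d psi phi * derive1 (premium tau d psi) phi.

Definition eqW tau d psi phi i : R :=
  lambertW (d 0 i * premium tau d psi phi * tau ^+ 2 / psi 0 i).

Definition share tau d psi phi i : R :=
  d 0 i * expR (- eqW tau d psi phi i)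
  / \sum_(j < N) d 0 j * expR (- eqW tau d psi phi j).

Definition omega tau d psi phi : R :=
  \sum_(i < N) share tau d psi phi i
               * (eqW tau d psi phi i / (1 + eqW tau d psi phi i)).

End model.

(* Main.v *)
(* Writing D for the aggregate shortfall and W' = W / (x (1 + W)), one gets
   - p D'(p) = D(p) omega at the equilibrium p.  The premium is the inverse of
   the map p |-> p / D(p), whose derivative is (1 + omega) / D(p); hence the
   elasticity is 1 / (1 + omega).
   For the limit, p >= phi d_i e^{-W_i} and W_i e^{W_i} = d_i p tau^2 / psi_i
   give W_i e^{2 W_i} >= phi tau^2 d_i^2 / psi_i, so that W_i -> +oo whenever
   d_i > 0, although p itself may tend to 0; thus omega -> 1. *)
Require Import Defs.
From HB Require Import structures.
From mathcomp Require Import all_boot all_order all_algebra.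
From mathcomp Require Import all_classical all_reals all_analysis.
From mathcomp Require Import ring lra.
Import Order.TTheory GRing.Theory Num.Theory.
Import numFieldNormedType.Exports.
Local Open Scope classical_set_scope.
Local Open Scope ring_scope.

(** * The Lambert function on the nonnegative half-line *)

Section lambert.
Context {R : realType}.
Implicit Types x y : R.

Lemma xexpR_lt x y : 0 <= x -> x < y -> x * expR x < y * expR y.
Proof.
move=> x0 xy; apply: (@le_lt_trans _ _ (x * expR y)).
  by rewrite ler_wpM2l// ler_expR ltW.
by rewrite ltr_pM2r// expR_gt0.
Qed.

Lemma lambertWK y : 0 <= y -> lambertW (y * expR y) = y.
Proof.
move=> y0; apply: pinvKV => [a b|]; last by rewrite inE /= in_itv /= y0.
rewrite !inE /= !in_itv /= !andbT => a0 b0 eab.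
by case: (ltgtP a b) => // [/(xexpR_lt _ _ a0)|/(xexpR_lt _ _ b0)];
  rewrite eab ltxx.
Qed.

Lemma is_derive_xexpR x :
  is_derive x 1 (fun y : R => y * expR y) ((1 + x) * expR x).
Proof.
have dM := @is_deriveM _ _ id expR x 1 _ _ (is_derive_id _ _) (is_derive_expR x).
by apply: (is_derive_eq dM); rewrite /GRing.scale /=; ring.
Qed.

(** The intermediate value theorem on [0, x] gives a preimage of x under y e^y, because x <= x e^x;
    [lambertWK] identifies it with [lambertW x]. *)
Lemma lambertW_spec x : 0 <= x ->
  0 <= lambertW x /\ lambertW x * expR (lambertW x) = x.
Proof.
move=> x0.
have xle : x <= x * expR x.
  by rewrite ler_peMr// -expR0 ler_expR.
have [||y] := @IVT _ (fun y : R => y * expR y) 0 x x x0.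
- apply: derivable_within_continuous => z _.
  by apply: ex_derive; apply: is_derive_xexpR.
- by rewrite mul0r ge_min le_max x0 xle orbT.
by rewrite in_itv /= => /andP[y0 _] <-; rewrite lambertWK.
Qed.

Lemma lambertW_ge0 x : 0 <= x -> 0 <= lambertW x.
Proof. by case/lambertW_spec. Qed.

Lemma lambertW_xexpR x : 0 <= x -> lambertW x * expR (lambertW x) = x.
Proof. by case/lambertW_spec. Qed.

Lemma lambertW_gt0 x : 0 < x -> 0 < lambertW x.
Proof.
move=> x0; have [W0 Wx] := lambertW_spec _ (ltW x0).
rewrite lt_neqAle W0 andbT; apply: contraTneq x0 => W00.
by rewrite -Wx -W00 mul0r ltxx.
Qed.

Lemma lambertW_le : {in Num.nneg &, {homo @lambertW R : x y / x <= y}}.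
Proof.
move=> x y; rewrite !nnegrE => x0 y0; apply: contra_le => /xexpR_lt.
by rewrite !lambertW_xexpR//; apply; rewrite lambertW_ge0.
Qed.

(** Inverse function rule at the point [lambertW x]: for x > 0 it has a neighbourhood of positive
    reals, on which [lambertWK] gives the cancellation. *)
Lemma is_derive_lambertW x : 0 < x ->
  is_derive x 1 (@lambertW R) (lambertW x / (x * (1 + lambertW x))).
Proof.
move=> x0; have W0 := lambertW_gt0 _ x0; have Wx := lambertW_xexpR _ (ltW x0).
(* Substituting x = W e^W turns the value into the reciprocal of the derivative of y e^y at W. *)
have -> : lambertW x / (x * (1 + lambertW x)) =
    ((1 + lambertW x) * expR (lambertW x))^-1.
  move: (lambertW x) W0 Wx => w w0 <-; field.
  by rewrite !gt_eqF ?expR_gt0//; lra.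
rewrite -{1}Wx; apply: (@is_derive_inverse _ (fun y : R => y * expR y)).
- near=> y; apply: lambertWK; apply: ltW.
  by near: y; apply: lt_nbhsr.
- near=> y; apply: differentiable_continuous; apply/derivable1_diffP.
  by apply: ex_derive; apply: is_derive_xexpR.
- exact: is_derive_xexpR.
- by rewrite mulf_neq0// gt_eqF ?expR_gt0//; lra.
Unshelve. all: by end_near.
Qed.

End lambert.

Lemma sumr_gt0_exists (R : numDomainType) (I : finType) (F : I -> R) :
  (forall i, 0 <= F i) -> 0 < \sum_i F i <-> exists i, 0 < F i.
Proof.
move=> F0; split=> [|[i Fi]].
  rewrite lt0r psumr_neq0 => [/andP[/hasP[i _ /= Fi] _]|i _]; last exact: F0.
  by exists i.
by rewrite (bigD1 i)//= ltr_pwDl// sumr_ge0.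
Qed.

(** * The aggregate shortfall and its derivative *)

Section equilibrium.
Context {R : realType} {N : nat} (tau : R) (d psi : 'rV[R]_N).
Implicit Types (p q phi : R) (i : 'I_N).
Context (tau_gt0 : 0 < tau) (d_ge0 : forall i, 0 <= d 0 i).
Context (sumd_gt0 : 0 < \sum_i d 0 i) (psi_gt0 : forall i, 0 < psi 0 i).

Let D := agg_shortfall tau d psi.
Let arg p i := d 0 i * p * tau ^+ 2 / psi 0 i.

Let arg_ge0 p i : 0 <= p -> 0 <= arg p i.
Proof. by move=> p0; rewrite divr_ge0 ?mulr_ge0 ?sqr_ge0// ltW. Qed.

Let arg_gt0 p i : 0 < p -> 0 < d 0 i -> 0 < arg p i.
Proof. by move=> p0 di0; rewrite divr_gt0 ?mulr_gt0 ?exprn_gt0. Qed.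

Let W p i := lambertW (arg p i).

Let W_ge0 p i : 0 <= p -> 0 <= W p i.
Proof. by move=> p0; apply/lambertW_ge0/arg_ge0. Qed.

Let termE p i : expR (- (opt_rate tau d psi p i * tau)) = expR (- W p i).
Proof. by rewrite /opt_rate mulrAC mulVf ?mul1r// gt_eqF. Qed.

Lemma agg_shortfallE p : D p = \sum_i d 0 i * expR (- W p i).
Proof. by apply: eq_bigr => i _; rewrite termE. Qed.

Lemma agg_shortfall_gt0 p : 0 < D p.
Proof.
have /sumr_gt0_exists[//|i di] := sumd_gt0.
apply/sumr_gt0_exists => [j|]; first by rewrite mulr_ge0// expR_ge0.
by exists i; rewrite mulr_gt0// expR_gt0.
Qed.

Lemma agg_shortfall_le : {in Num.nneg &, {homo D : p q /~ p <= q}}.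
Proof.
move=> q p; rewrite !nnegrE => q0 p0 pq; rewrite !agg_shortfallE.
apply: ler_sum => i _; rewrite ler_wpM2l// ler_expR lerN2.
apply: lambertW_le; rewrite ?nnegrE ?arg_ge0// /arg.
rewrite ler_wpM2r ?invr_ge0 ?(ltW (psi_gt0 _))//.
by rewrite ler_wpM2r ?sqr_ge0// ler_wpM2l.
Qed.

Lemma agg_shortfall_le_sum p : 0 <= p -> D p <= \sum_i d 0 i.
Proof.
move=> p0; rewrite agg_shortfallE; apply: ler_sum => i _.
by rewrite ler_piMr// -expR0 ler_expR oppr_le0 W_ge0.
Qed.

(** The Lambert argument is linear in p, so its slope cancels against the x in W' = W / (x (1 + W))
    and leaves the common factor 1 / p. *)
Lemma is_derive_agg_shortfall p : 0 < p ->
  is_derive p 1 D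
    (- (p^-1 * \sum_i d 0 i * expR (- W p i) * (W p i / (1 + W p i)))).
Proof.
move=> p0.
pose f i q := d 0 i * expR (- W q i).
have -> : D = \sum_i f i by apply/funext => q; rewrite agg_shortfallE fct_sumE.
rewrite mulr_sumr -sumrN; apply: is_derive_sum => i.
(* If d_i = 0 the Lambert argument is 0, where [is_derive_lambertW] does not apply, but the term is
   then identically zero. *)
have [di0|dip] := eqVneq (d 0 i) 0.
  have -> : f i = cst 0 by apply/funext => q; rewrite /f di0 mul0r.
  by rewrite di0 !mul0r mulr0 oppr0; apply: is_derive_cst.
have di : 0 < d 0 i by rewrite lt_neqAle eq_sym dip d_ge0.
have ap := arg_gt0 _ _ p0 di.
pose c := d 0 i * tau ^+ 2 / psi 0 i.
have argE q : arg q i = c * q by rewrite /arg /c; ring.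
have darg : is_derive p 1 (fun q : R => arg q i) c.
  rewrite (_ : (fun q => _) = (c \*: id)); last first.
    by apply/funext => q; rewrite argE.
  have dZ := @is_deriveZ _ _ _ id c p 1 _ (is_derive_id _ _).
  by apply: (is_derive_eq dZ); rewrite /GRing.scale /= mulr1.
have dW := @is_derive1_comp _ _ (arg^~ i) _ _ _ (is_derive_lambertW _ ap) darg.
have dN := is_deriveN dW.
have dE := is_derive1_comp (is_derive_expR _) dN.
have dZ := is_deriveZ (d 0 i) dE.
apply: (is_derive_eq dZ).
have W0 := W_ge0 _ i (ltW p0).
have cp : c != 0 by rewrite !mulf_neq0 ?invr_eq0 ?expf_neq0 ?gt_eqF.
rewrite /GRing.scale /= -/(W p i) argE.
have -> : (- (@lambertW R \o (fun q : R => arg q i))) p = - W p i by [].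
field.
by rewrite cp andbT; apply/andP; split; rewrite gt_eqF//; lra.
Qed.

(** * Existence and uniqueness of the equilibrium *)

Lemma equilibrium_uniq phi p q : 0 < phi ->
  is_equilibrium tau d psi phi p -> is_equilibrium tau d psi phi q -> p = q.
Proof.
move=> phi0; wlog pq : p q / p < q.
  move=> wl ep eq_q; case: (ltgtP p q) => // [/wl|/wl H]; first exact.
  by apply/esym/H.
(* As [D] is nonincreasing, p < q would give q = phi D(q) <= phi D(p) = p. *)
move=> [p0 ep] [q0 eq_q]; suff: q <= p by rewrite leNgt pq.
rewrite eq_q [leRHS]ep ler_pM2l//.
by apply: agg_shortfall_le; rewrite ?nnegrE ltW.
Qed.

Lemma equilibrium_exists phi : 0 < phi ->
  exists p, is_equilibrium tau d psi phi p.
Proof.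
move=> phi0.
(* The interval starts at some m > 0 because continuity of D is only
   available, through its derivative, away from 0. *)
pose M := phi * \sum_i d 0 i; pose m := Num.min (phi * D M) M.
have M0 : 0 < M by rewrite mulr_gt0.
have m0 : 0 < m by rewrite lt_min M0 mulr_gt0// agg_shortfall_gt0.
have mM : m <= M by rewrite ge_min lexx orbT.
pose h p := p - phi * D p.
(* From m <= M and the monotonicity of [D], m <= phi D(M) <= phi D(m). At the other end, M dominates
   phi D because D never exceeds the sum of the d_i. *)
have hm : h m <= 0.
  rewrite subr_le0 (@le_trans _ _ (phi * D M)) ?ge_min ?lexx// ler_pM2l//.
  by apply: agg_shortfall_le => //; rewrite nnegrE ltW.
have hM : 0 <= h M.
  by rewrite subr_ge0 ler_pM2l// agg_shortfall_le_sum// ltW.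
have [||p] := @IVT _ h m M 0 mM.
- apply: derivable_within_continuous => p; rewrite in_itv /= => /andP[mp _].
  have /(is_deriveZ phi) dD := is_derive_agg_shortfall _ (lt_le_trans m0 mp).
  have dh : is_derive p 1 h _ := is_deriveB (is_derive_id p 1) dD.
  exact: ex_derive.
- by rewrite ge_min le_max hm hM orbT.
rewrite in_itv /= => /andP[mp _] /eqP; rewrite subr_eq0 => /eqP hp.
by exists p; split=> //; exact: lt_le_trans mp.
Qed.

Lemma premium_equilibrium phi : 0 < phi ->
  is_equilibrium tau d psi phi (premium tau d psi phi).
Proof. by move=> /equilibrium_exists; exact: xgetPex. Qed.

Lemma premium_eq phi p : 0 < phi ->
  is_equilibrium tau d psi phi p -> premium tau d psi phi = p.
Proof.
by move=> phi0; apply: equilibrium_uniq => //; exact: premium_equilibrium.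
Qed.

(** Every p > 0 is the equilibrium for exactly one phi, namely p / D(p). The premium thus inverts an
    explicit map, and the inverse function rule suffices to differentiate it. *)
Lemma premiumK p : 0 < p -> premium tau d psi (p / D p) = p.
Proof.
move=> p0; have D0 := agg_shortfall_gt0 p; apply: premium_eq.
  by rewrite divr_gt0.
by split=> //; rewrite divfK// gt_eqF.
Qed.

(** * Derivative of the premium and the elasticity formula *)

Lemma omegaE phi :
  omega tau d psi phi =
    (D (premium tau d psi phi))^-1 *
    \sum_i d 0 i * expR (- eqW tau d psi phi i) *
           (eqW tau d psi phi i / (1 + eqW tau d psi phi i)).
Proof.
rewrite agg_shortfallE mulr_sumr; apply: eq_bigr => i _.
by rewrite /share mulrAC [LHS]mulrC.
Qed.

Lemma is_derive_premium phi : 0 < phi ->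
  is_derive phi 1 (premium tau d psi)
    (D (premium tau d psi phi) / (1 + omega tau d psi phi)).
Proof.
move=> phi0; have [p0 ep] := premium_equilibrium _ phi0.
have omega0 : 0 <= omega tau d psi phi.
  rewrite omegaE mulr_ge0 ?invr_ge0 ?(ltW (agg_shortfall_gt0 _))//.
  apply: sumr_ge0 => i _; have := W_ge0 _ i (ltW p0); rewrite -/(eqW _ _ _ _ _) => w0.
  by rewrite !mulr_ge0 ?expR_ge0 ?invr_ge0// addr_ge0.
have Dn0 q : D q != 0 by rewrite gt_eqF// agg_shortfall_gt0.
pose p := premium tau d psi phi; rewrite -/p in p0 ep omega0 *.
(* Stated for all q > 0: the value of the derivative is used at [p] only, but the inverse function
   rule also asks for continuity near [p]. *)
have dg q : 0 < q -> exists2 l, is_derive q 1 (fun q => q / D q) l &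
  l = (D q)^-1 * (1 + (D q)^-1 *
    \sum_i d 0 i * expR (- W q i) * (W q i / (1 + W q i))).
  move=> q0; have dV := is_deriveV (Dn0 q) (is_derive_agg_shortfall _ q0).
  eexists; first exact: is_deriveM (is_derive_id q 1) dV.
  rewrite /GRing.scale /=; set S := \sum_i _; field.
  by rewrite Dn0 gt_eqF.
have phiE : phi = p / D p by rewrite {1}ep mulfK.
have [l dl lE] := dg p p0.
have l_eq : l = (1 + omega tau d psi phi) / D p by rewrite lE omegaE mulrC.
have l0 : l != 0.
  by rewrite l_eq mulf_neq0 ?invr_eq0// gt_eqF// ltr_pwDl.
have premiumK_near : {near p, cancel (fun q => q / D q) (premium tau d psi)}.
  near=> q; apply: premiumK.
  by near: q; apply: lt_nbhsr.
have g_cont : {near p, continuous (fun q => q / D q)}.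
  near=> q; apply: differentiable_continuous; apply/derivable1_diffP.
  have [|l' dl' _] := dg q; last exact: ex_derive.
  by near: q; apply: lt_nbhsr.
have dI := is_derive_inverse premiumK_near g_cont dl l0.
by rewrite -phiE l_eq invfM invrK mulrC in dI.
Unshelve. all: by end_near.
Qed.

Lemma elasticityE phi : 0 < phi ->
  elasticity tau d psi phi = 1 / (1 + omega tau d psi phi).
Proof.
move=> phi0; have [p0 ep] := premium_equilibrium _ phi0.
have := is_derive_premium _ phi0; rewrite /elasticity derive1E => dP.
rewrite derive_val; move: (premium _ _ _ _) p0 ep dP => p p0 ep dP.
have D0 := agg_shortfall_gt0 p.
rewrite mulrA; congr (_ / _).
(* Only the denominator is replaced by phi D(p); the [p] inside [D p] must stay. *)
rewrite [X in _ / X]ep -/D; field.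
by rewrite !gt_eqF.
Qed.

(** * Bounds on [omega] *)

Lemma share_ge0 phi i : 0 <= share tau d psi phi i.
Proof.
by rewrite divr_ge0 ?mulr_ge0 ?expR_ge0// sumr_ge0// => j _; rewrite mulr_ge0 ?expR_ge0.
Qed.

Lemma share_gt0 phi i : 0 < d 0 i -> 0 < share tau d psi phi i.
Proof.
move=> di; rewrite divr_gt0 ?mulr_gt0 ?expR_gt0//.
by rewrite -agg_shortfallE agg_shortfall_gt0.
Qed.

Lemma sum_share phi : \sum_i share tau d psi phi i = 1.
Proof.
rewrite -mulr_suml mulfV// -agg_shortfallE.
by rewrite gt_eqF// agg_shortfall_gt0.
Qed.

Lemma eqW_ge0 phi i : 0 < phi -> 0 <= eqW tau d psi phi i.
Proof. by move=> /premium_equilibrium [p0 _]; apply/W_ge0/ltW. Qed.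

Lemma eqW_gt0 phi i : 0 < phi -> 0 < d 0 i -> 0 < eqW tau d psi phi i.
Proof.
by move=> /premium_equilibrium [p0 _] di; apply/lambertW_gt0/arg_gt0.
Qed.

Lemma omega_gt0 phi : 0 < phi -> 0 < omega tau d psi phi.
Proof.
move=> phi0; have /sumr_gt0_exists[//|i di] := sumd_gt0.
apply/sumr_gt0_exists => [j|].
  by rewrite mulr_ge0 ?share_ge0// divr_ge0 ?addr_ge0 ?eqW_ge0.
exists i; rewrite mulr_gt0 ?share_gt0// divr_gt0 ?addr_gt0 ?eqW_gt0//.
Qed.

(** The shares sum to 1 and 1 - w / (1 + w) = 1 / (1 + w). This form serves both the bound [omega] <
    1 and the limit. *)
Lemma onem_omega phi : 0 < phi ->
  1 - omega tau d psi phi =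
  \sum_i share tau d psi phi i / (1 + eqW tau d psi phi i).
Proof.
move=> phi0; rewrite -[X in X - _](sum_share phi) -sumrB; apply: eq_bigr => i _.
have w0 := eqW_ge0 _ i phi0; field; rewrite gt_eqF//; lra.
Qed.

Lemma omega_lt1 phi : 0 < phi -> omega tau d psi phi < 1.
Proof.
move=> phi0; have /sumr_gt0_exists[//|i di] := sumd_gt0.
rewrite -subr_gt0 onem_omega//; apply/sumr_gt0_exists => [j|].
  by rewrite divr_ge0 ?share_ge0// addr_ge0 ?eqW_ge0.
exists i; rewrite divr_gt0 ?share_gt0// addr_gt0 ?eqW_gt0//.
Qed.

(** * The limit of vanishing access costs *)

Lemma eqW_lower phi i (K : R) : 0 < phi -> 0 < d 0 i -> 0 <= K ->
  psi 0 i * (K * expR (2 * K)) <= phi * tau ^+ 2 * d 0 i ^+ 2 ->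
  K <= eqW tau d psi phi i.
Proof.
(* If W_i < K, strict growth of x e^{2x} puts the left side above psi_i W_i e^{2 W_i}, which is at
   least phi tau^2 d_i^2. *)
move=> phi0 di K0; apply: contraTT; rewrite -!ltNge => wK.
have [p0 ep] := premium_equilibrium _ phi0.
have w0 := eqW_ge0 _ i phi0.
have := lambertW_xexpR _ (arg_ge0 _ i (ltW p0)).
rewrite -/(eqW _ _ _ _ _).
set w := eqW _ _ _ _ i in wK w0 *; set p := premium _ _ _ _ in p0 ep *.
move=> wE.
(* Keeping only the i-th term of the equilibrium equation bounds [p] below in terms of [w], which
   eliminates [p] from the estimate. *)
have dp : phi * (d 0 i * expR (- w)) <= p.
  rewrite [leRHS]ep ler_pM2l// -/D agg_shortfallE (bigD1 i)//= lerDl.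
  by apply: sumr_ge0 => j _; rewrite mulr_ge0// expR_ge0.
have e2 (x : R) : x * expR (2 * x) = x * expR x * expR x.
  by rewrite mulrDl !mul1r expRD mulrA.
apply: (@le_lt_trans _ _ (psi 0 i * (w * expR (2 * w)))); last first.
  by rewrite ltr_pM2l// !e2 ltr_pM ?mulr_ge0 ?expR_ge0 ?xexpR_lt ?ltr_expR.
have dp' : phi * d 0 i <= p * expR w.
  by rewrite -ler_pdivrMr ?expR_gt0// -expRN -mulrA.
rewrite e2 wE mulrA (mulrC (psi 0 i)) divfK ?gt_eqF//.
have -> : phi * tau ^+ 2 * d 0 i ^+ 2 = d 0 i * tau ^+ 2 * (phi * d 0 i).
  by ring.
have -> : d 0 i * p * tau ^+ 2 * expR w = d 0 i * tau ^+ 2 * (p * expR w).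
  by ring.
by rewrite ler_wpM2l// mulr_ge0 ?sqr_ge0.
Qed.

(** The distance is (1 - omega) / (2 (1 + omega)) <= 1 - omega, and 1 - omega is the share-weighted
    mean of the 1 / (1 + W_i). *)
Lemma elasticity_dist_half phi (K : R) : 0 < phi -> 0 <= K ->
  (forall i, 0 < d 0 i -> K <= eqW tau d psi phi i) ->
  `|elasticity tau d psi phi - 1 / 2| <= (1 + K)^-1.
Proof.
move=> phi0 K0 wK.
have o0 := omega_gt0 _ phi0; have o1 := omega_lt1 _ phi0.
have oK : 1 - omega tau d psi phi <= (1 + K)^-1.
  rewrite onem_omega// -[leRHS]mul1r -[X in _ <= X * _](sum_share phi) mulr_suml.
  (* Operators with d_i = 0 escape the bound on W_i but have zero share. *)
  apply: ler_sum => i _; have [di0|di] := leP (d 0 i) 0.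
    have -> : share tau d psi phi i = 0.
      by rewrite /share (_ : d 0 i = 0) ?mul0r//; apply/eqP; rewrite eq_le di0 d_ge0.
    by rewrite !mul0r.
  have w0 := eqW_ge0 _ i phi0.
  by rewrite ler_wpM2l ?share_ge0// lef_pV2 ?posrE ?lerD2l ?wK// ltr_pwDl.
rewrite elasticityE//; apply: le_trans oK.
set o := omega _ _ _ _ in o0 o1 *.
rewrite (_ : 1 / (1 + o) - 1 / 2 = (1 - o) / (2 * (1 + o))); last first.
  by field; rewrite gt_eqF//; lra.
rewrite ger0_norm; last by rewrite divr_ge0; lra.
by rewrite ler_pdivrMr; nra.
Qed.

End equilibrium.

(** Existence, uniqueness and derivability belong to the conclusion so that [premium] and [derive1]
    are known not to take default values. *)
Theorem corollary3 (R : realType) (N : nat) (tau phi : R) (d : 'rV[R]_N)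
    (tau_gt0 : 0 < tau) (phi_gt0 : 0 < phi)
    (d_ge0 : forall i : 'I_N, 0 <= d 0 i)
    (sumd_gt0 : 0 < \sum_(i < N) d 0 i) :
  (forall psi : 'rV[R]_N, (forall i : 'I_N, 0 < psi 0 i) ->
    (is_equilibrium tau d psi phi (premium tau d psi phi) /\
     (forall p : R, is_equilibrium tau d psi phi p ->
        p = premium tau d psi phi)) /\
    derivable (premium tau d psi) phi 1 /\
    elasticity tau d psi phi = 1 / (1 + omega tau d psi phi) /\
    (forall i : 'I_N, 0 < d 0 i ->
       0 < eqW tau d psi phi i / (1 + eqW tau d psi phi i) < 1) /\
    0 < omega tau d psi phi < 1 /\
    1 / 2 < elasticity tau d psi phi < 1) /\
  elasticity tau d psi phi
    @[psi --> within [set psi : 'rV[R]_N | forall i : 'I_N, 0 < psi 0 i]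
                     (nbhs (0 : 'rV[R]_N))]
    --> (1 / 2 : R).
Proof.
split=> [psi psi_gt0|].
  have o0 := omega_gt0 _ _ _ tau_gt0 d_ge0 sumd_gt0 psi_gt0 _ phi_gt0.
  have o1 := omega_lt1 _ _ _ tau_gt0 d_ge0 sumd_gt0 psi_gt0 _ phi_gt0.
  have eE := elasticityE _ _ _ tau_gt0 d_ge0 sumd_gt0 psi_gt0 _ phi_gt0.
  split; last split; last split; last split; last split => //.
  - split=> [|p ep]; first exact: premium_equilibrium.
    by apply/esym; exact: premium_eq.
  - by apply: ex_derive; exact: is_derive_premium.
  - exact: eE.
  - move=> i di.
    have w0 := eqW_gt0 _ _ _ tau_gt0 d_ge0 sumd_gt0 psi_gt0 _ _ phi_gt0 di.
    by rewrite divr_gt0 ?ltr_pdivrMr; lra.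
  - by rewrite o0.
  - rewrite eE; set o := omega _ _ _ _ in o0 o1 *.
    by rewrite ltr_pdivlMr ?ltr_pdivrMr; lra.
apply/cvgrPdist_le => e e0; rewrite near_withinE.
(* With this choice (1 + K)^-1 <= K^-1 = e. *)
pose K : R := e^-1; have K0 : 0 < K by rewrite invr_gt0.
have KE : 0 < K * expR (2 * K) by rewrite mulr_gt0 ?expR_gt0.
(* The threshold comes from [eqW_lower]; it is positive only for d_i > 0, hence the implication
   under the filter. *)
have psi_small i : \forall psi \near (0 : 'rV[R]_N), 0 < d 0 i ->
    (psi : 'rV[R]_N) 0 i <= phi * tau ^+ 2 * d 0 i ^+ 2 / (K * expR (2 * K)).
  have [di|di0] := ltP 0 (d 0 i); last first.
    by near=> psi.
  have := @coord_continuous _ 1 N 0 i (0 : 'rV[R]_N).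
  move/cvgr_le; rewrite mxE => /(_ (phi * tau ^+ 2 * d 0 i ^+ 2 / (K * expR (2 * K)))).
  rewrite !(divr_gt0, mulr_gt0, exprn_gt0, expR_gt0)// => /(_ isT); apply: filterS => psi le _.
  exact: le.
near=> psi => /= psi_gt0.
(* There are finitely many operators, so one neighbourhood of 0 works for all of them. *)
have small i : 0 < d 0 i ->
    psi 0 i <= phi * tau ^+ 2 * d 0 i ^+ 2 / (K * expR (2 * K)).
  by move: i; near: psi; apply: filter_forall.
rewrite distrC; apply: (@le_trans _ _ (1 + K)^-1).
  apply: elasticity_dist_half => //; first exact: ltW.
  move=> i di; apply: eqW_lower => //; first exact: ltW.
  by rewrite -ler_pdivlMr// small.
by rewrite -[leRHS]invrK lef_pV2 ?posrE ?addr_gt0// lerDr.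
Unshelve. all: by end_near.
Qed.
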